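(* Let $\langle G_m,\pi_{m,n}:m\le n<\omega\rangle$ be an inverse system of finite groups (so $\pi_{m,n}:G_n\to G_m$ are homomorphisms, $\pi_{m,m}$ is the identity and $\pi_{k,m}\circ\pi_{m,n}=\pi_{k,n}$ for $k\le m\le n$), with inverse limit $G_\omega$ and projections $\pi_{n,\omega}:G_\omega\to G_n$. Let $\mathbf I$ be a countable index set, and for each $t\in\mathbf I$ let $\langle H^t_m,\pi^t_{m,n}:m\le n<\omega\rangle$ be an inverse system of finite groups with inverse limit $H^t_\omega$ and projections $\pi^t_{n,\omega}$. For each $t\in\mathbf I$ and $n<\omega$ let $\sigma^t_n:H^t_n\to G_n$ be a homomorphism such that $\pi_{m,n}\circ\sigma^t_n=\sigma^t_m\circ\pi^t_{m,n}$ for all $m\le n<\omega$, and let $\sigma^t_\omega:H^t_\omega\to G_\omega$ be the induced homomorphism. Assume that for every finite $k$ there is a sequence $\langle f_i\in G_\omega:i<k\rangle$ such that $f_if_j^{-1}\notin\operatorname{Rang}(\sigma^t_\omega)$ whenever $i\neq j$ and $t\in\mathbf I$. Then there is a sequence $\langle f_i\in G_\omega:i<2^{\aleph_0}\rangle$ such that $f_if_j^{-1}\notin\operatorname{Rang}(\sigma^t_\omega)$ whenever $i\neq j<2^{\aleph_0}$ and $t\in\mathbf I$.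
   Context: $\operatorname{Rang}(\sigma)$ denotes the image of the homomorphism $\sigma$. *)

(* Defs.v *)
From HB Require Import structures.
From mathcomp Require Import all_boot all_fingroup.
From mathcomp Require Import boolp classical_sets.

Set Implicit Arguments.
Unset Strict Implicit.
Unset Printing Implicit Defensive.

Local Open Scope group_scope.

Record invSystem := InvSystem {
  sys_obj :> nat -> finGroupType;
  sys_map : forall m n : nat, (m <= n)%N ->
    UMagmaMorphism.type (sys_obj n) (sys_obj m);
  sys_map_id : forall (n : nat) (le_nn : (n <= n)%N) (x : sys_obj n),
    sys_map le_nn x = x;
  sys_map_comp : forall (k m n : nat)
      (le_km : (k <= m)%N) (le_mn : (m <= n)%N) (le_kn : (k <= n)%N)
      (x : sys_obj n),
    sys_map le_km (sys_map le_mn x) = sys_map le_kn x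
}.

Record invSystemHom (H G : invSystem) := InvSystemHom {
  hom_at :> forall n : nat, UMagmaMorphism.type (H n) (G n);
  hom_atP : forall (m n : nat) (le_mn : (m <= n)%N) (x : H n),
    sys_map G le_mn (hom_at n x) = hom_at m (sys_map H le_mn x)
}.

(* The standard model of the inverse limit: the compatible threads in the
   product of the G n, with the coordinates as projections. *)
Record invLim (G : invSystem) := InvLim {
  lim_proj : forall n : nat, G n;
  lim_projP : forall (m n : nat) (le_mn : (m <= n)%N),
    sys_map G le_mn (lim_proj n) = lim_proj m
}.

Section InvLimGroup.
Variable G : invSystem.
Implicit Types x y z : invLim G.

Lemma invLim_eq x y : (forall n, lim_proj x n = lim_proj y n) -> x = y.
Proof.
case: x y => [x xP] [y yP] /= eq_xy.
have {}eq_xy : x = y by apply: functional_extensionality_dep.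
by subst y; congr InvLim; apply: Prop_irrelevance.
Qed.

HB.instance Definition _ := gen_eqMixin (invLim G).
HB.instance Definition _ := gen_choiceMixin (invLim G).

Fact lim_one_subproof (m n : nat) (le_mn : (m <= n)%N) :
  sys_map G le_mn (1 : G n) = 1.
Proof. exact: gmulf1. Qed.

Fact lim_mul_subproof x y (m n : nat) (le_mn : (m <= n)%N) :
  sys_map G le_mn (lim_proj x n * lim_proj y n) = lim_proj x m * lim_proj y m.
Proof. by rewrite gmulfM !lim_projP. Qed.

Fact lim_inv_subproof x (m n : nat) (le_mn : (m <= n)%N) :
  sys_map G le_mn (lim_proj x n)^-1 = (lim_proj x m)^-1.
Proof. by rewrite gmulfV lim_projP. Qed.

Definition lim_one : invLim G := InvLim lim_one_subproof.
Definition lim_mul x y : invLim G := InvLim (lim_mul_subproof x y).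
Definition lim_inv x : invLim G := InvLim (lim_inv_subproof x).

Fact lim_mulA : associative lim_mul.
Proof. by move=> x y z; apply: invLim_eq => n; apply: mulgA. Qed.

Fact lim_mul1 : left_id lim_one lim_mul.
Proof. by move=> x; apply: invLim_eq => n; apply: mul1g. Qed.

Fact lim_mulr1 : right_id lim_one lim_mul.
Proof. by move=> x; apply: invLim_eq => n; apply: mulg1. Qed.

Fact lim_mulV : left_inverse lim_one lim_inv lim_mul.
Proof. by move=> x; apply: invLim_eq => n; apply: mulVg. Qed.

Fact lim_mulrV : right_inverse lim_one lim_inv lim_mul.
Proof. by move=> x; apply: invLim_eq => n; apply: mulgV. Qed.

HB.instance Definition _ := isGroup.Build (invLim G)
  lim_mulA lim_mul1 lim_mulr1 lim_mulV lim_mulrV.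

End InvLimGroup.

Section InducedHom.
Variables (H G : invSystem) (s : invSystemHom H G).

Fact lim_hom_subproof (x : invLim H) (m n : nat) (le_mn : (m <= n)%N) :
  sys_map G le_mn (s n (lim_proj x n)) = s m (lim_proj x m).
Proof. by rewrite hom_atP lim_projP. Qed.

(* The unique map s_w with lim_proj (s_w x) n = s n (lim_proj x n). *)
Definition lim_hom (x : invLim H) : invLim G := InvLim (lim_hom_subproof x).

Fact lim_hom_monoid_morphism : monoid_morphism lim_hom.
Proof.
by split=> [|x y]; apply: invLim_eq => n /=; [apply: gmulf1 | apply: gmulfM].
Qed.

HB.instance Definition _ :=
  isUMagmaMorphism.Build (invLim H) (invLim G) lim_hom
    lim_hom_monoid_morphism.

End InducedHom.

(* Main.v *)
(** Among [#|G n| + 1] of the given elements two agree at level [n], so every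
    basic neighbourhood of [1] contains an element outside all the ranges.  As
    each range is closed (by compactness), it is nowhere dense.  One then takes
    [f_eta] to be the infinite product of the [g_k ^ eta (i_k)], where [k] codes
    a pair [(i_k, t_k)] and [g_k], very close to [1], is chosen so that
    [p * g_k * q^-1] stays away from the range for [t_k] for all of the finitely
    many partial products [p], [q] of length [k].  If [eta] and [nu] differ at
    [i], the stage coding [(i, t)] separates [f_eta] from [f_nu]. *)
Require Import Defs.
From mathcomp Require Import all_boot all_fingroup.
From mathcomp Require Import boolp classical_sets cardinality.

Set Implicit Arguments.
Unset Strict Implicit.
Unset Printing Implicit Defensive.

Local Open Scope group_scope.
Local Open Scope classical_set_scope.

Lemma lim_projM (G : invSystem) (x y : invLim G) (n : nat) :
  lim_proj (x * y) n = lim_proj x n * lim_proj y n.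
Proof. by []. Qed.

Lemma lim_projV (G : invSystem) (x : invLim G) (n : nat) :
  lim_proj x^-1 n = (lim_proj x n)^-1.
Proof. by []. Qed.

Lemma lim_proj_le (G : invSystem) (x y : invLim G) (m n : nat) :
  (m <= n)%N -> lim_proj x n = lim_proj y n -> lim_proj x m = lim_proj y m.
Proof. by move=> le_mn eq_n; rewrite -!(lim_projP _ le_mn) eq_n. Qed.

(** If each [y] failed at some [b y], antitonicity would make all of them fail at the maximum of
    [b]. *)
Lemma antitone_pigeonhole (T : finType) (P : T -> nat -> Prop) :
  (forall y m n, (m <= n)%N -> P y n -> P y m) ->
  (forall n, exists y, P y n) -> exists y, forall n, P y n.
Proof.
move=> Pdecr Pex; apply: contrapT => /forallNP noP.
have /choice[b bP] (y : T) : exists n, ~ P y n by apply/existsNP/noP.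
have [y Py] := Pex (\max_y b y).
by apply: (bP y); apply: Pdecr Py; apply: leq_bigmax.
Qed.

(** Compactness of the inverse limit, by a König-style construction level by level. The invariant
    [Q n h] says that every [C m] meets the basic neighbourhood of [h] at level [n]. *)
Lemma decreasing_cluster (H : invSystem) (C : nat -> set (invLim H)) :
  (forall m n, (m <= n)%N -> C n `<=` C m) -> (forall n, C n !=set0) ->
  exists h : invLim H, forall n m,
    exists2 h', C m h' & lim_proj h' n = lim_proj h n.
Proof.
move=> Cdecr C0.
pose Q n h := forall m, exists2 h', C m h' & lim_proj h' n = lim_proj h n.
have Q0 : exists h, Q 0%N h.
  have [y Py] : exists y : H 0%N, forall m, exists2 h, C m h & lim_proj h 0%N = y.
    apply: antitone_pigeonhole => [y m n le_mn [h Ch <-]|n].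
      by exists h => //; apply: Cdecr Ch.
    by have [h Ch] := C0 n; exists (lim_proj h 0%N), h.
  by have [h _ hy] := Py 0%N; exists h => m; rewrite hy.
have QS n h : Q n h -> exists h', Q n.+1 h' /\ lim_proj h' n = lim_proj h n.
  move=> Qh.
  have [y Py] : exists y : H n.+1, forall m,
      exists2 h', C m h' & lim_proj h' n = lim_proj h n /\ lim_proj h' n.+1 = y.
    apply: antitone_pigeonhole => [y m k le_mk [h' Ch' yP]|m].
      by exists h' => //; apply: Cdecr Ch'.
    by have [h' Ch' h'h] := Qh m; exists (lim_proj h' n.+1), h'.
  have [h' _ [h'h h'y]] := Py 0%N; exists h'; split=> // m.
  by have [k Ck [_ ky]] := Py m; exists k => //; rewrite ky h'y.
(* Choice needs a total function; outside [Q] the value is arbitrary. *)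
have /choice[next nextP] (nh : nat * invLim H) : exists h',
    Q nh.1 nh.2 -> Q nh.1.+1 h' /\ lim_proj h' nh.1 = lim_proj nh.2 nh.1.
  by have [/QS[h']|nQ] := pselect (Q nh.1 nh.2); [exists h' | exists nh.2].
have [h0 Qh0] := Q0.
pose a := fix a n := if n is n'.+1 then next (n', a n') else h0.
have Qa n : Q n (a n).
  by elim: n => [|n IHn] //=; have [] := nextP (n, a n) IHn.
have a_le m n : (m <= n)%N -> lim_proj (a n) m = lim_proj (a m) m.
  elim: n => [|n IHn]; first by rewrite leqn0 => /eqP->.
  rewrite leq_eqVlt => /predU1P[->//|]; rewrite ltnS => le_mn.
  rewrite -IHn //; apply: (lim_proj_le le_mn).
  by have [] := nextP (n, a n) (Qa n).
(* Coordinate [m] of [a n] is constant from [n = m] on, so the diagonal is a thread. *)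
have aP m n (le_mn : (m <= n)%N) :
    sys_map H le_mn (lim_proj (a n) n) = lim_proj (a m) m.
  by rewrite lim_projP a_le.
by exists (InvLim aP) => n m; apply: Qa.
Qed.

(** The preimages of the neighbourhoods of [x] decrease and are nonempty; any cluster point of them
    is mapped to [x]. *)
Lemma range_lim_hom_closed (H G : invSystem) (s : invSystemHom H G)
    (x : invLim G) :
  (forall n, exists2 y, range (lim_hom s) y & lim_proj y n = lim_proj x n) ->
  range (lim_hom s) x.
Proof.
move=> x_adh.
have [m n le_mn h /(lim_proj_le le_mn)//|n|h hP] :=
  @decreasing_cluster H (fun n h => lim_proj (lim_hom s h) n = lim_proj x n).
  by have [_ [h _ <-] hx] := x_adh n; exists h.
exists h => //; apply: invLim_eq => n; have [h' <- /= ->//] := hP n n.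
Qed.

Lemma range_lim_homM (H G : invSystem) (s : invSystemHom H G) (x y : invLim G) :
  range (lim_hom s) x -> range (lim_hom s) y -> range (lim_hom s) (x * y).
Proof. by move=> [h _ <-] [k _ <-]; exists (h * k); rewrite ?gmulfM. Qed.

Lemma range_lim_homV (H G : invSystem) (s : invSystemHom H G) (x : invLim G) :
  range (lim_hom s) x -> range (lim_hom s) x^-1.
Proof. by move=> [h _ <-]; exists h^-1; rewrite ?gmulfV. Qed.

(** Agreement with [x] at level [n] is a basic open neighbourhood of [x]; each one must contain
    another that misses [K]. *)
Definition nowhere_dense_lim (G : invSystem) (K : set (invLim G)) :=
  forall (x : invLim G) (n : nat), exists (y : invLim G) (m : nat),
    [/\ (n <= m)%N, lim_proj y n = lim_proj x n &
        forall z, lim_proj z m = lim_proj y m -> ~ K z].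

Lemma range_lim_hom_nowhere_dense (H G : invSystem) (s : invSystemHom H G) :
  (forall n, exists2 h : invLim G, lim_proj h n = 1 & ~ range (lim_hom s) h) ->
  nowhere_dense_lim (range (lim_hom s)).
Proof.
move=> small x n.
have [y yx Ky] : exists2 y, lim_proj y n = lim_proj x n & ~ range (lim_hom s) y.
  have [Kx|] := pselect (range (lim_hom s) x); last by exists x.
  (* The range is a subgroup, so [x] inside and [h] outside put [x * h] outside. *)
  have [h h1 Kh] := small n; exists (x * h); first by rewrite lim_projM h1 mulg1.
  by move=> /(range_lim_homM (range_lim_homV Kx)); rewrite mulKg.
have [m mP] : exists m, forall z, lim_proj z m = lim_proj y m ->
    ~ range (lim_hom s) z.
  apply: contrapT => /forallNP noM; apply: Ky; apply: range_lim_hom_closed => m.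
  have /existsNP[z /not_implyP[zy /contrapT Kz]] := noM m.
  by exists z.
exists y, (maxn n m); split=> [|//|z zy]; first exact: leq_maxl.
by apply: mP; apply: lim_proj_le zy; apply: leq_maxr.
Qed.

(** The pairs are treated one at a time. A point [y] near [p * g * q^-1] pulls back to
    [p^-1 * y * q], which agrees with [g] at level [m], so the pairs already handled stay
    separated. *)
Lemma nowhere_dense_step (G : invSystem) (K : set (invLim G))
    (P : seq (invLim G * invLim G)) (n : nat) :
  nowhere_dense_lim K -> exists (g : invLim G) (m : nat),
    [/\ (n < m)%N, lim_proj g n = 1 &
        forall p, p \in P -> forall z,
          lim_proj z m = lim_proj (p.1 * g * p.2^-1) m -> ~ K z].
Proof.
move=> ndK; elim: P => [|[p q] P [g [m [lt_nm g1 gP]]]]; first by exists 1, n.+1.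
have [y [m' [le_mm' yE yP]]] := ndK (p * g * q^-1) m.
have gE : lim_proj (p^-1 * y * q) m = lim_proj g m.
  by rewrite !lim_projM yE !lim_projM !lim_projV !mulgA mulVg mul1g mulgKV.
exists (p^-1 * y * q), m'; split=> [||p' + z].
- exact: leq_trans le_mm'.
- by rewrite (lim_proj_le (ltnW lt_nm) gE).
- rewrite inE => /predU1P[-> /=|Pp'] zE.
    by apply: yP; rewrite zE !mulgA mulgV mul1g mulgK.
  apply: (gP p' Pp'); rewrite (lim_proj_le le_mm' zE).
  by rewrite lim_projM (lim_projM p'.1) gE.
Qed.

Lemma nowhere_dense_separation (G : invSystem) (K : nat -> set (invLim G)) :
  (forall k, nowhere_dense_lim (K k)) ->
  exists f : (nat -> bool) -> invLim G,
    forall (a b : nat -> bool) (k : nat), a k -> ~~ b k ->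
      ~ K k (f a * (f b)^-1).
Proof.
move=> ndK.
pose state := (seq (invLim G) * nat)%type.
have /choice[g /choice[l glP]] (ks : nat * state) :=
  @nowhere_dense_step G (K ks.1) [seq (p, q) | p <- ks.2.1, q <- ks.2.1]
    ks.2.2 (ndK ks.1).
(* A state lists the partial products of length [k] over all branches, with the level at which all
   later factors are trivial. Hence the factor [g (k, S k)] is common to all branches. *)
pose S := fix S k : state := if k is k'.+1 then
  ((S k').1 ++ [seq p * g (k', S k') | p <- (S k').1], l (k', S k'))
  else ([:: 1], 0%N).
pose pre a := fix pre k : invLim G := if k is k'.+1 then
  (if a k' then pre k' * g (k', S k') else pre k') else 1.
have pre_in a k : pre a k \in (S k).1.
  elim: k => [|k IHk] /=; first by rewrite inE.
  rewrite mem_cat; case: (a k); last by rewrite IHk.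
  by apply/orP; right; apply: map_f.
have lvlS k : ((S k).2 < (S k.+1).2)%N by have [] := glP (k, S k).
have lvl_le j k : (j <= k)%N -> ((S j).2 <= (S k).2)%N.
  apply: (homo_leq (f := fun i => (S i).2) leqnn leq_trans) => i.
  exact/ltnW/lvlS.
have lvl_ge k : (k <= (S k).2)%N.
  by elim: k => // k IHk; apply: leq_ltn_trans IHk (lvlS k).
have pre_lvl a j k : (j <= k)%N ->
    lim_proj (pre a k) (S j).2 = lim_proj (pre a j) (S j).2.
  elim: k => [|k IHk]; first by rewrite leqn0 => /eqP->.
  rewrite leq_eqVlt => /predU1P[->//|]; rewrite ltnS => le_jk.
  rewrite -IHk //; apply: (lim_proj_le (lvl_le _ _ le_jk)) => /=.
  case: (a k) => //; rewrite lim_projM.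
  by have [_ -> _] := glP (k, S k); rewrite mulg1.
(* The level of stage [m] is at least [m], so [pre a m] already has its final coordinate [m]. *)
have fP a m n (le_mn : (m <= n)%N) :
    sys_map G le_mn (lim_proj (pre a n) n) = lim_proj (pre a m) m.
  by rewrite lim_projP; apply: (lim_proj_le (lvl_ge m)); apply: pre_lvl.
exists (fun a => InvLim (fP a)) => a b k ak bk.
have [_ _ sep] := glP (k, S k).
apply: (sep (pre a k, pre b k)); first by apply: allpairs_f; apply: pre_in.
(* At the level of stage [k.+1] both limits equal their prefixes of length [k.+1]; only the one for
   [a] has picked up the factor [g (k, S k)]. *)
rewrite -/(S k.+1).2 !lim_projM !lim_projV /=.
have fE c : lim_proj (pre c (S k.+1).2) (S k.+1).2
          = lim_proj (pre c k.+1) (S k.+1).2 by apply: pre_lvl.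
by rewrite !fE /= ak (negbTE bk).
Qed.

Lemma agreeing_pair_avoiding (G : invSystem) (A : set (invLim G)) :
  (forall k : nat, exists f : 'I_k -> invLim G,
     forall i j : 'I_k, i <> j -> ~ A (f i * (f j)^-1)) ->
  forall n, exists2 h : invLim G, lim_proj h n = 1 & ~ A h.
Proof.
move=> Af n; have [f fP] := Af #|G n|.+1.
have /injectivePn[i [j /eqP ij fij]] :
    ~~ injectiveb (fun i => lim_proj (f i) n).
  by apply/injectiveP => /leq_card; rewrite card_ord ltnn.
by exists (f i * (f j)^-1); [rewrite lim_projM lim_projV fij mulgV | apply: fP].
Qed.

Theorem theorem1p1 (G : invSystem) (I : Type) (countableI : countable [set: I])
    (H : I -> invSystem) (sigma : forall t : I, invSystemHom (H t) G) :
  (forall k : nat, exists f : 'I_k -> invLim G,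
     forall (i j : 'I_k) (t : I), i <> j ->
       ~ range (lim_hom (sigma t)) (f i * (f j)^-1)) ->
  exists f : (nat -> bool) -> invLim G,
    forall (i j : nat -> bool) (t : I), i <> j ->
      ~ range (lim_hom (sigma t)) (f i * (f j)^-1).
Proof.
move=> ex_f.
have nd t : nowhere_dense_lim (range (lim_hom (sigma t))).
  apply: range_lim_hom_nowhere_dense; apply: agreeing_pair_avoiding => k.
  by have [f fP] := ex_f k; exists f => i j; apply: fP.
have [e e_inj] : exists e : I -> nat, injective e.
  have /countable_injP[e e_inj] := countableI.
  by exists e => t u; apply: e_inj; rewrite in_setT.
(* The default is harmless: separation only uses stages of the form [pickle (i, e t)]. *)
pose d k : nat * nat := odflt (0, 0)%N (unpickle k).
pose K k : set (invLim G) :=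
  [set x | exists2 t, e t = (d k).2 & range (lim_hom (sigma t)) x].
have ndK k : nowhere_dense_lim (K k).
  have [[t et]|/forallNP no_t] := pselect (exists t, e t = (d k).2).
    rewrite (_ : K k = range (lim_hom (sigma t))); first exact: nd.
    apply/seteqP; split=> x; last by exists t.
    by move=> [u]; rewrite -et => /e_inj->.
  (* Here [K k] is empty. *)
  move=> x n; exists x, n; split=> // z _ [t et _]; exact: no_t et.
have [f fP] := nowhere_dense_separation ndK.
exists (fun a => f (fun k => a (d k).1)) => a b t ab Kab.
have [i abi] : exists i, a i <> b i.
  by apply/existsNP => eq_ab; apply: ab; apply/funext.
pose k := pickle (i, e t).
have dk : d k = (i, e t) by rewrite /d pickleK.
pose F (c : nat -> bool) := f (fun k => c (d k).1).
have sep c c' : c i = true -> c' i = false ->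
    ~ range (lim_hom (sigma t)) (F c * (F c')^-1).
  move=> ci c'i Kcc'.
  apply: (fP (fun k => c (d k).1) (fun k => c' (d k).1) k);
    rewrite /= ?dk ?ci ?c'i //.
  by exists t; rewrite ?dk.
(* [sep] needs the bit of its first argument to be true; in the other case, invert, as the range is
   closed under inverses. *)
case ai: (a i) abi; case bi: (b i) => // _; first exact: sep ai bi Kab.
by apply: (sep b a bi ai); have := range_lim_homV Kab; rewrite invMg invgK.
Qed.
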